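(* Let $\Lambda=\Gamma\times\Phi\subset\mathbb R^{2d}$, where $\Gamma,\Phi\subset\mathbb R^d$ are full-rank lattices. Then $\Lambda$ satisfies condition (SG) if and only if the pair $(\Gamma,\Phi^* )$ satisfies condition (T$\epsilon$P). If $\Gamma+\Phi^*$ is not discrete, the common condition is $\operatorname{covol}(\Gamma)<\operatorname{covol}(\Phi^* )$, equivalently $\operatorname{covol}(\Lambda)<1$. If $\Gamma+\Phi^*$ is a lattice, then $$\nu(\Lambda)=[\Gamma+\Phi^*:\Phi^*],\qquad \nu(\Lambda^\circ)=[\Gamma+\Phi^*:\Gamma],$$ and the common condition is $[\Gamma+\Phi^*:\Phi^*]\ge[\Gamma+\Phi^*:\Gamma]+d$.
   Context: A full-rank lattice in $\mathbb R^n$ is $L=M\mathbb Z^n$ with $M\in GL_n(\mathbb R)$, $\operatorname{covol}(L)=|\det M|$; the Euclidean dual of $L\subset\mathbb R^d$ is $L^*=\{\xi\in\mathbb R^d:\xi\cdot\ell\in\mathbb Z\ \forall\ell\in L\}$. Put $\sigma((x,\xi),(y,\eta))=\eta\cdot x-\xi\cdot y$, $\Lambda^\circ=\{z\in\mathbb R^{2d}:\sigma(z,\lambda)\in\mathbb Z\ \forall\lambda\in\Lambda\}$ and $\Lambda_{\rm int}=\Lambda\cap\Lambda^\circ$. $\Lambda$ is symplectically rational if $[\Lambda:\Lambda_{\rm int}]<\infty$; then $\nu(\Lambda)=[\Lambda:\Lambda_{\rm int}]^{1/2}$ and $\Delta(\Lambda)=\nu(\Lambda)-\nu(\Lambda^\circ)$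 ($\Lambda^\circ$ is then also symplectically rational). Condition (SG) for a full-rank lattice $\Lambda\subset\mathbb R^{2d}$: $\operatorname{covol}(\Lambda)<1$ and, if $\Lambda$ is symplectically rational, $\Delta(\Lambda)\ge d$. Condition (T$\epsilon$P) for a pair $(T,P)$ of full-rank lattices in $\mathbb R^d$: $\operatorname{covol}(T)<\operatorname{covol}(P)$ and, if $T+P$ is discrete, $[T+P:P]\ge[T+P:T]+d$. *)

(* Defs.v *)
From HB Require Import structures.
From mathcomp Require Import all_boot all_order all_algebra.
From mathcomp Require Import finmap.
From mathcomp Require Import all_classical all_reals all_analysis.

Set Implicit Arguments.
Unset Strict Implicit.
Unset Printing Implicit Defensive.

Import Order.TTheory GRing.Theory Num.Theory.
Import numFieldNormedType.Exports.

Local Open Scope classical_set_scope.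
Local Open Scope ring_scope.

Section Lattices.
Context {R : realType}.

Definition latticeOf n (M : 'M[R]_n) : set 'cV[R]_n :=
  [set M *m map_mx intr z | z in [set: 'cV[int]_n]].

Definition fullRankLattice n (L : set 'cV[R]_n) : Prop :=
  exists2 M : 'M[R]_n, M \in unitmx & L = latticeOf M.

(* [|det M|] for a chosen basis matrix [M] of [L]; the choice is immaterial by
   [covolE] below, and the value is irrelevant if [L] is not a full-rank lattice. *)
Definition covol n (L : set 'cV[R]_n) : R :=
  get [set c | exists M : 'M[R]_n,
                 [/\ M \in unitmx, L = latticeOf M & c = `|\det M|]].

Definition dotv n (x y : 'cV[R]_n) : R := \sum_i x i 0 * y i 0.

Definition dualLattice n (L : set 'cV[R]_n) : set 'cV[R]_n :=
  [set xi | forall l, L l -> dotv xi l \is a Num.int].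

Definition sumSet n (A B : set 'cV[R]_n) : set 'cV[R]_n :=
  [set a + b | a in A & b in B].

Definition discreteSubset n (A : set 'cV[R]_n) : Prop := isolated A = A.

Definition cosets n (A B : set 'cV[R]_n) : set (set 'cV[R]_n) :=
  [set [set a + b | b in B] | a in A].

Definition finiteIndex n (A B : set 'cV[R]_n) : Prop := finite_set (cosets A B).

(* [A : B] for a subgroup [B] of [A]; it is 0 when the index is infinite. *)
Definition grpIndex n (A B : set 'cV[R]_n) : nat := #|` fset_set (cosets A B)|.

(* A point (x, xi) of R^{2d} is [col_mx x xi]. *)
Definition prodSet d (A B : set 'cV[R]_d) : set 'cV[R]_(d + d) :=
  [set col_mx x xi | x in A & xi in B].

Definition sympl d (z w : 'cV[R]_(d + d)) : R :=
  dotv (dsubmx w) (usubmx z) - dotv (dsubmx z) (usubmx w).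

Definition adjointLattice d (L : set 'cV[R]_(d + d)) : set 'cV[R]_(d + d) :=
  [set z | forall l, L l -> sympl z l \is a Num.int].

Definition integralPart d (L : set 'cV[R]_(d + d)) : set 'cV[R]_(d + d) :=
  L `&` adjointLattice L.

Definition symplRational d (L : set 'cV[R]_(d + d)) : Prop :=
  finiteIndex L (integralPart L).

Definition nu d (L : set 'cV[R]_(d + d)) : R :=
  Num.sqrt (grpIndex L (integralPart L))%:R.

Definition Delta d (L : set 'cV[R]_(d + d)) : R := nu L - nu (adjointLattice L).

Definition condSG d (L : set 'cV[R]_(d + d)) : Prop :=
  covol L < 1 /\ (symplRational L -> d%:R <= Delta L).

Definition condTeP d (T P : set 'cV[R]_d) : Prop :=
  covol T < covol P /\
  (discreteSubset (sumSet T P) ->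
   (grpIndex (sumSet T P) T + d <= grpIndex (sumSet T P) P)%N).

Lemma latticeOf_sub n (M N : 'M[R]_n) : latticeOf M `<=` latticeOf N ->
  exists A : 'M[int]_n, M = N *m map_mx intr A.
Proof.
move=> MN.
have H (j : 'I_n) : exists z : 'cV[int]_n, col j M = N *m map_mx intr z.
  have [|z _ <-] := MN (col j M); last by exists z.
  exists (delta_mx j 0) => //.
  by rewrite map_delta_mx colE.
have [z zP] := choice H.
exists (\matrix_(i, j) z j i 0); apply/matrixP => i j.
have := congr1 (fun v : 'cV[R]_n => v i 0) (zP j); rewrite !mxE => ->.
by apply: eq_bigr => k _; rewrite !mxE.
Qed.

Lemma covolE n (M : 'M[R]_n) : M \in unitmx -> covol (latticeOf M) = `|\det M|.
Proof.
move=> uM; rewrite /covol.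
have /getPex [N [uN MN ->]] : exists c : R, exists N : 'M[R]_n,
    [/\ N \in unitmx, latticeOf M = latticeOf N & c = `|\det N|].
  by exists `|\det M|, M.
have [A NA] : exists A : 'M[int]_n, N = M *m map_mx intr A.
  by apply: latticeOf_sub; rewrite MN.
have [B MB] : exists B : 'M[int]_n, M = N *m map_mx intr B.
  by apply: latticeOf_sub; rewrite MN.
have key (X Y : 'M[R]_n) (C : 'M[int]_n) : Y \in unitmx ->
    Y = X *m map_mx intr C -> `|\det X| <= `|\det Y|.
  move=> uY YE; have dY : \det Y = \det X * (\det C)%:~R.
    by rewrite YE det_mulmx det_map_mx.
  have C0 : \det C != 0.
    by apply: contraTneq uY => C0; rewrite unitmxE dY C0 mulr0 unitr0.
  rewrite dY normrM ler_peMr// -intr_norm ler1z.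
  by rewrite -gtz0_ge1 normr_gt0.
by apply/eqP; rewrite eq_le (key _ _ _ uM MB) (key _ _ _ uN NA).
Qed.

End Lattices.

(* Main.v *)
(* If [Gamma] and [P = dualLattice Phi] are commensurable, the Smith normal form
   gives a basis [C] of R^d and nonzero integers [a_i], [b_i], coprime for each
   [i], with [Gamma = C diag(a) Z^d] and [P = C diag(b) Z^d].  Then
   [[Gamma + P : P] = prod |b_i|] and [[Gamma + P : Gamma] = prod |a_i|], while
   dualizing gives lattices [Phi] and [dualLattice Gamma] that are aligned with
   the same [a] and [b] in another basis.  Hence
   [Lambda / (Lambda cap Lambda^o)] = [Gamma / (Gamma cap P)] x
   [Phi / (Phi cap dualLattice Gamma)] has order [(prod |b_i|)^2], and exchanging
   [a] and [b] treats the adjoint.  The covolumes of [Gamma] and [P] are in ratio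
   [prod |a_i| : prod |b_i|], so that the index inequality forces the covolume
   inequality.  By the pigeonhole principle, discreteness of [Gamma + P] and
   symplectic rationality of [Lambda] each make every element of [Gamma] torsion
   modulo [P], that is, make [Gamma] and [P] commensurable; otherwise both
   conditions reduce to the covolume inequality. *)
Require Import Defs.
From mathcomp Require Import all_boot all_order all_algebra.
From mathcomp Require Import finmap.
From mathcomp Require Import all_classical all_reals all_analysis.
From mathcomp Require Import lra.
Set Implicit Arguments.
Unset Strict Implicit.
Unset Printing Implicit Defensive.
Import Order.TTheory GRing.Theory Num.Theory.
Import numFieldNormedType.Exports.
Local Open Scope classical_set_scope.
Local Open Scope ring_scope.

(** * Subgroups of R^n, cosets and indices *)

Definition isSubgroup {R : realType} {n : nat} (A : set 'cV[R]_n) : Prop :=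
  A 0 /\ forall x y, A x -> A y -> A (x - y).

(* [f] lists one representative in [A] of each coset of [A `&` B] in [A]; [B] need
   not be contained in [A]. *)
Definition cosetReps {R : realType} {n : nat} {F : finType}
    (f : F -> 'cV[R]_n) (A B : set 'cV[R]_n) : Prop :=
  [/\ forall x, A (f x), forall v, A v -> exists x, B (v - f x)
    & forall x y, B (f x - f y) -> x = y].

Section Subgroups.
Context {R : realType} {n : nat}.
Implicit Types A B : set 'cV[R]_n.

Lemma isSubgroupN A x : isSubgroup A -> A x -> A (- x).
Proof. by move=> [A0 AB] Ax; rewrite -sub0r; exact: AB. Qed.

Lemma isSubgroupD A x y : isSubgroup A -> A x -> A y -> A (x + y).
Proof.
move=> hA Ax Ay; rewrite -[y]opprK; apply: hA.2 => //; exact: isSubgroupN.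
Qed.

Lemma isSubgroupMn A x k : isSubgroup A -> A x -> A (x *+ k).
Proof.
move=> hA Ax; elim: k => [|k IH]; first by rewrite mulr0n; exact: hA.1.
by rewrite mulrS; exact: isSubgroupD.
Qed.

Lemma isSubgroup_sumSet A B : isSubgroup A -> isSubgroup B ->
  isSubgroup (sumSet A B).
Proof.
move=> hA hB; split.
  by exists 0; [exact: hA.1|exists 0; [exact: hB.1|rewrite addr0]].
move=> _ _ [a Aa [b Bb <-]] [a' Aa' [b' Bb' <-]].
exists (a - a'); first exact: hA.2.
by exists (b - b'); [exact: hB.2|rewrite opprD addrACA].
Qed.

Lemma sumSetC A B : sumSet A B = sumSet B A.
Proof.
by apply/seteqP; split=> _ [a Aa [b Bb <-]]; exists b => //; exists a;
  rewrite // addrC.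
Qed.

Lemma coset_eqP B x y : isSubgroup B ->
  [set x + b | b in B] = [set y + b | b in B] <-> B (x - y).
Proof.
move=> hB; split=> [xy|Bxy].
  have : [set x + b | b in B] x by exists 0; [exact: hB.1|rewrite addr0].
  by rewrite xy => -[b Bb <-]; rewrite addrAC subrr add0r.
apply/seteqP; split=> _ [b Bb <-].
  by exists (x - y + b); [exact: isSubgroupD|rewrite addrA subrKC].
exists (b - (x - y)); first exact: hB.2.
by rewrite addrCA opprB subrKC addrC.
Qed.

(** The map sending [x] to the coset of [f x] is a bijection from [F] onto [cosets A B]. Every index
    below is computed from an explicit list of representatives in this way. *)
Lemma index_cosetReps (F : finType) (f : F -> 'cV[R]_n) A B :
  isSubgroup B -> cosetReps f A B -> finiteIndex A B /\ grpIndex A B = #|F|.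
Proof.
move=> hB [Af fA finj].
pose g x := [set f x + b | b in B].
have gE : cosets A B = [set g x | x in [set: F]].
  apply/seteqP; split=> [_ [a Aa <-]|_ [x _ <-]]; last by exists (f x).
  have [x Bx] := fA a Aa; exists x => //.
  apply/coset_eqP => //; rewrite -opprB; exact: isSubgroupN.
have ginj : injective g.
  by move=> x y /coset_eqP; move/(_ hB); exact: finj.
have finF : finite_set [set: F] by exact: finite_finset.
rewrite /finiteIndex /grpIndex gE; split; first exact: finite_image.
rewrite fset_set_image// card_imfset//=.
rewrite (_ : fset_set _ = [fset x | x in F]%fset) ?card_fset//.
  by rewrite card_imfset// -cardE.
by apply/fsetP => x; rewrite in_fset_set// in_setT; symmetry; apply/imfsetP; exists x.
Qed.

(** Second isomorphism theorem: [A / (A cap B)] and [(A + B) / B] share their representatives, since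
    the [B]-part of a sum is absorbed by the coset. *)
Lemma cosetReps_sumSet (F : finType) (f : F -> 'cV[R]_n) A B :
  isSubgroup B -> cosetReps f A B -> cosetReps f (sumSet A B) B.
Proof.
move=> hB [Af fA finj]; split=> // [x|_ [a Aa [b Bb <-]]].
  by exists (f x) => //; exists 0; [exact: hB.1|rewrite addr0].
by have [x Bx] := fA a Aa; exists x; rewrite addrAC; exact: isSubgroupD.
Qed.

(** The pigeonhole principle: some value is taken on an infinite set of indices. *)
Lemma finite_range_collision (T : Type) (u : nat -> T) :
  finite_set (range u) -> exists k l, (k < l)%N /\ u k = u l.
Proof.
move=> /finite_range_cst_subsequence [x [S iS uS]].
have [k Sk] : S !=set0 by exact: infinite_setN0.
have [l [Sl kl]] : exists l, S l /\ l != k.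
  have [l [Sl /eqP kl]] : (S `\ k) !=set0.
    apply: infinite_setN0; apply: infinite_setD => //; exact: finite_set1.
  by exists l; split=> //; apply/eqP.
have uk : u k = u l by rewrite (uS k).1// (uS l).1.
have [kl'|lk|e] := ltngtP k l; [by exists k, l|by exists l, k|].
by rewrite e eqxx in kl.
Qed.

(** Two of the multiples [v *+ k] fall into the same coset, and their difference is the required
    multiple. *)
Lemma finiteIndex_torsion A B v : isSubgroup A -> isSubgroup B ->
  finiteIndex A B -> A v -> exists2 N : nat, (0 < N)%N & B (v *+ N).
Proof.
move=> hA hB fAB Av.
have [|k [l [kl]]] := @finite_range_collision _ (fun k => [set v *+ k + b | b in B]).
  apply: sub_finite_set fAB => _ [k _ <-]; exists (v *+ k) => //.
  exact: isSubgroupMn.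
move=> /esym /(coset_eqP _ _ hB) Bv.
by exists (l - k)%N; rewrite ?subn_gt0// mulrnBr// ltnW.
Qed.

End Subgroups.

(** * Product sets and the symplectic adjoint of a product *)

Section Products.
Context {R : realType} {d : nat}.
Implicit Types A B : set 'cV[R]_d.

Lemma prodSetP A B x y : prodSet A B (col_mx x y) <-> A x /\ B y.
Proof.
split=> [[x' Ax' [y' By' /eq_col_mx[<- <-]]]//|[Ax By]].
by exists x => //; exists y.
Qed.

Lemma isSubgroup_prodSet A B : isSubgroup A -> isSubgroup B ->
  isSubgroup (prodSet A B).
Proof.
move=> hA hB; split.
  by rewrite -col_mx0; apply/prodSetP; split; [exact: hA.1|exact: hB.1].
move=> _ _ [a Aa [b Bb <-]] [a' Aa' [b' Bb' <-]].
by rewrite opp_col_mx add_col_mx; apply/prodSetP; split; [exact: hA.2|exact: hB.2].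
Qed.

(** The intersection of the two products is [(A cap B) x (A' cap B')], so pairs of representatives
    represent the quotient. *)
Lemma cosetReps_prodSet (F G : finType) (f : F -> 'cV[R]_d) (g : G -> 'cV[R]_d)
    A B A' B' :
  isSubgroup A -> isSubgroup A' -> cosetReps f A B -> cosetReps g A' B' ->
  cosetReps (fun x : F * G => col_mx (f x.1) (g x.2))
    (prodSet A A') (prodSet A A' `&` prodSet B B').
Proof.
move=> hA hA' [Af fA finj] [Ag gA ginj]; split=> [x|_ [a Aa [a' Aa' <-]]|].
- exact/prodSetP.
- have [x Bx] := fA a Aa; have [y By] := gA a' Aa'.
  exists (x, y); rewrite opp_col_mx add_col_mx.
  by split; apply/prodSetP; split=> //; [exact: hA.2|exact: hA'.2].
- move=> [x y] [x' y'] [_]; rewrite opp_col_mx add_col_mx => /prodSetP[/= Bx By].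
  by rewrite (finj _ _ Bx) (ginj _ _ By).
Qed.

Lemma dotvC (x y : 'cV[R]_d) : dotv x y = dotv y x.
Proof. by apply: eq_bigr => i _; rewrite mulrC. Qed.

Lemma dotv0 (x : 'cV[R]_d) : dotv x 0 = 0.
Proof. by rewrite /dotv big1// => i _; rewrite mxE mulr0. Qed.

(** Testing against [(0, l)] and [(l, 0)], which lie in the product because both factors contain 0,
    splits the symplectic condition into two Euclidean ones. The symplectic form pairs positions
    with frequencies, hence the exchange of the factors. *)
Lemma adjointLattice_prodSet A B : A 0 -> B 0 ->
  adjointLattice (prodSet A B) = prodSet (dualLattice B) (dualLattice A).
Proof.
move=> A0 B0; apply/seteqP; split=> z.
  rewrite -[z]vsubmxK => hz; apply/prodSetP; split=> l Ll.
    have := hz (col_mx 0 l); rewrite /sympl !(col_mxKu, col_mxKd) dotv0 subr0 dotvC.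
    by apply; apply/prodSetP.
  have := hz (col_mx l 0); rewrite /sympl !(col_mxKu, col_mxKd).
  rewrite [dotv 0 _]dotvC dotv0 sub0r rpredN.
  by apply; apply/prodSetP.
move=> [x hx [xi hxi <-]] _ [y Ay [eta Beta <-]].
rewrite /sympl !(col_mxKu, col_mxKd) rpredB ?hxi//.
by rewrite dotvC hx.
Qed.

End Products.

(** * Lattices given by matrices, and pairs diagonal in a common basis *)

Section AlignedLattices.
Context {R : realType}.
Local Notation "A ^R" := (map_mx intr A) (at level 8, format "A ^R").

Lemma map_intr_inj {m n} : injective (map_mx intr : 'M[int]_(m, n) -> 'M[R]_(m, n)).
Proof.
move=> X Y /matrixP XY; apply/matrixP => i j.
by have := XY i j; rewrite !mxE => /intr_inj.
Qed.

Lemma latticeOfP {n} (M : 'M[R]_n) v :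
  latticeOf M v <-> exists z : 'cV[int]_n, v = M *m z^R.
Proof. by split=> [[z _ <-]|[z ->]]; exists z. Qed.

Lemma isSubgroup_latticeOf {n} (M : 'M[R]_n) : isSubgroup (latticeOf M).
Proof.
split; first by apply/latticeOfP; exists 0; rewrite map_mx0 mulmx0.
move=> _ _ [y _ <-] [z _ <-].
by apply/latticeOfP; exists (y - z); rewrite map_mxB mulmxBr.
Qed.

Lemma latticeOf_mul_unit {n} (M : 'M[R]_n) (U : 'M[int]_n) : U \in unitmx ->
  latticeOf (M *m U^R) = latticeOf M.
Proof.
move=> uU; apply/seteqP; split=> _ [z _ <-]; apply/latticeOfP.
  by exists (U *m z); rewrite map_mxM mulmxA.
by exists (invmx U *m z); rewrite -mulmxA -map_mxM mulKVmx.
Qed.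

(** Moving [M] across the dot product gives [xi . (M z) = (M^T xi) . z], which is an integer for all
    integral [z] exactly when [M^T xi] is integral. *)
Lemma dualLattice_latticeOf {n} (M : 'M[R]_n) : M \in unitmx ->
  dualLattice (latticeOf M) = latticeOf (invmx M^T).
Proof.
move=> uM; have dotE (z : 'cV[int]_n) xi :
    dotv xi (M *m z^R) = \sum_j (M^T *m xi) j 0 * (z j 0)%:~R.
  rewrite /dotv; under eq_bigr do rewrite mxE mulr_sumr.
  rewrite exchange_big /=; apply: eq_bigr => j _; rewrite [in RHS]mxE mulr_suml.
  by apply: eq_bigr => i _; rewrite !mxE mulrA [_ * xi _ _]mulrC.
apply/seteqP; split=> [xi hxi|_ [y _ <-] _ [z _ <-]].
  have /choice[y hy] (j : 'I_n) : exists m : int, (M^T *m xi) j 0 = m%:~R.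
    apply/intrP; have /hxi : latticeOf M (M *m (delta_mx j 0)^R).
      by apply/latticeOfP; exists (delta_mx j 0).
    rewrite dotE (bigD1 j)//= big1 ?addr0 ?[in X in _ * X]mxE ?eqxx ?mulr1// => i ij.
    by rewrite !mxE (negPf ij) mulr0.
  apply/latticeOfP; exists (\col_j y j).
  rewrite (_ : _^R = M^T *m xi) ?mulKmx ?unitmx_tr//.
  by apply/colP => j; rewrite [LHS]mxE mxE -hy.
rewrite dotE rpred_sum// => j _.
by rewrite mulKVmx ?unitmx_tr// mxE rpredM ?intr_int.
Qed.

Lemma prodSet_latticeOf {d} (M N : 'M[R]_d) :
  prodSet (latticeOf M) (latticeOf N) = latticeOf (block_mx M 0 0 N).
Proof.
have blockE (x y : 'cV[R]_d) :
    block_mx M 0 0 N *m col_mx x y = col_mx (M *m x) (N *m y).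
  by rewrite mul_block_col !mul0mx addr0 add0r.
apply/seteqP; split=> [_ [_ [x _ <-] [_ [y _ <-] <-]]|_ [z _ <-]].
  by apply/latticeOfP; exists (col_mx x y); rewrite map_col_mx blockE.
rewrite -[z]vsubmxK map_col_mx blockE; apply/prodSetP.
by split; apply/latticeOfP; [exists (usubmx z)|exists (dsubmx z)].
Qed.

Lemma covol_prodSet {d} (M N : 'M[R]_d) : M \in unitmx -> N \in unitmx ->
  covol (prodSet (latticeOf M) (latticeOf N)) =
  covol (latticeOf M) * covol (latticeOf N).
Proof.
move=> uM uN; rewrite prodSet_latticeOf !covolE//.
  by rewrite det_ublock normrM.
by rewrite unitmxE det_ublock unitrM -!unitmxE uM uN.
Qed.

Lemma covol_dualLattice {n} (M : 'M[R]_n) : M \in unitmx ->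
  covol (dualLattice (latticeOf M)) = (covol (latticeOf M))^-1.
Proof.
move=> uM; rewrite dualLattice_latticeOf// !covolE ?unitmx_inv ?unitmx_tr//.
by rewrite det_inv det_tr normfV.
Qed.

Lemma covol_latticeOf_gt0 {n} (M : 'M[R]_n) : M \in unitmx ->
  0 < covol (latticeOf M).
Proof. by move=> uM; rewrite covolE// normr_gt0 -unitfE -unitmxE. Qed.

Definition coprimePair {n} (a b : 'rV[int]_n) : Prop :=
  forall i, [/\ a 0 i != 0, b 0 i != 0 & coprimez (a 0 i) (b 0 i)].

(** Because of the coprimality, [C] is a basis of [A + B] and [C diag(a) diag(b)] one of
    [A cap B]. *)
Definition aligned {n} (a b : 'rV[int]_n) (A B : set 'cV[R]_n) : Prop :=
  coprimePair a b /\
  exists2 C : 'M[R]_n, C \in unitmx &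
    A = latticeOf (C *m (diag_mx a)^R) /\ B = latticeOf (C *m (diag_mx b)^R).

Lemma aligned_sym {n} (a b : 'rV[int]_n) A B : aligned a b A B -> aligned b a B A.
Proof.
move=> [ab [C uC [AE BE]]]; split; last by exists C.
by move=> i; have [? ? ?] := ab i; split=> //; rewrite coprimez_sym.
Qed.

Lemma unitmx_diagR {n} (a : 'rV[int]_n) : (forall i, a 0 i != 0) ->
  ((diag_mx a)^R : 'M[R]_n) \in unitmx.
Proof.
move=> a0; rewrite unitmxE unitfE det_map_mx intr_eq0 det_diag.
by apply/prodf_neq0 => i _.
Qed.

(** The new common basis is the dual basis of [C diag(a) diag(b)]. Multiplying it by [diag(a)]
    cancels [diag(a)] and leaves the dual basis of [C diag(b)], and likewise with [a] and [b]
    exchanged. *)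
Lemma aligned_dual {n} (a b : 'rV[int]_n) A B :
  aligned a b A B -> aligned a b (dualLattice B) (dualLattice A).
Proof.
move=> [ab [C uC [AE BE]]]; split=> //.
have ua : ((diag_mx a)^R : 'M[R]_n) \in unitmx.
  by apply: unitmx_diagR => i; case: (ab i).
have ub : ((diag_mx b)^R : 'M[R]_n) \in unitmx.
  by apply: unitmx_diagR => i; case: (ab i).
have invK (D X : 'M[R]_n) : D \in unitmx -> X \in unitmx ->
    invmx (D *m X) *m D = invmx X.
  move=> uD uX; apply: (can_inj (mulmxK uX)).
  by rewrite -mulmxA !mulVmx// unitmx_mul uD.
have tr_diag (c : 'rV[int]_n) : ((diag_mx c)^R : 'M[R]_n)^T = (diag_mx c)^R.
  by rewrite map_trmx tr_diag_mx.
exists (invmx (C *m (diag_mx a)^R *m (diag_mx b)^R)^T).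
  by rewrite unitmx_inv unitmx_tr !unitmx_mul uC ua ub.
rewrite AE BE !dualLattice_latticeOf ?unitmx_mul ?uC ?ua ?ub//.
split; congr latticeOf; last first.
  by rewrite [in RHS]trmx_mul tr_diag invK// unitmx_tr unitmx_mul uC ua.
rewrite -mulmxA -map_mxM diag_mxC map_mxM mulmxA [in RHS]trmx_mul tr_diag invK//.
by rewrite unitmx_tr unitmx_mul uC ub.
Qed.


Lemma dvdz_sub_ord (m : nat) (x y : 'I_m) : (m%:Z %| x%:Z - y%:Z)%Z -> x = y.
Proof.
rewrite -eqz_mod_dvd !modz_small ?lez_nat ?ltz_nat ?ltn_ord// => /eqP[].
exact: val_inj.
Qed.

(** A vector [C diag(a) z] lies in [B] iff [b_i] divides [a_i z_i] for all [i], that is, by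
    coprimality, iff [b_i] divides [z_i]. Thus [A / (A cap B)] is the product of the groups
    [Z / b_i], and vectors of residues represent it. *)
Lemma cosetReps_aligned {n} (a b : 'rV[int]_n) A B : aligned a b A B ->
  exists f : {dffun forall i : 'I_n, 'I_`|b 0 i|} -> 'cV[R]_n, cosetReps f A B.
Proof.
move=> [ab [C uC [-> ->]]].
have diagE (c : 'rV[int]_n) (z : 'cV[int]_n) i : (diag_mx c *m z) i 0 = c 0 i * z i 0.
  by rewrite mul_diag_mx mxE.
have subP (z z' : 'cV[int]_n) :
    latticeOf (C *m (diag_mx b)^R) (C *m (diag_mx a)^R *m z^R - C *m (diag_mx a)^R *m z'^R)
    <-> forall i, ((b 0 i)%R %| (z i 0 - z' i 0)%R)%Z.
  have -> : C *m (diag_mx a)^R *m z^R - C *m (diag_mx a)^R *m z'^R =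
      C *m (diag_mx a *m (z - z'))^R by rewrite map_mxM map_mxB mulmxA mulmxBr.
  split=> [/latticeOfP[y]|bz].
    rewrite -mulmxA -map_mxM => /(can_inj (mulKmx uC)) /map_intr_inj yE i.
    have [_ _] := ab i; rewrite coprimez_sym => /Gauss_dvdzr <-.
    have := congr1 (fun v : 'cV[int]_n => v i 0) yE; rewrite !diagE !mxE => ->.
    exact: dvdz_mulr.
  apply/latticeOfP; exists (\col_i (a 0 i * ((z i 0 - z' i 0)%R %/ (b 0 i)%R)%Z)).
  rewrite -mulmxA -map_mxM; congr (_ *m _^R); apply/colP => i.
  rewrite !diagE !mxE mulrCA; congr (_ * _).
  by rewrite mulrC divzK.
exists (fun x : {dffun forall i : 'I_n, 'I_`|b 0 i|} =>
  C *m (diag_mx a)^R *m (\col_i (x i : nat)%:Z)^R); split.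
- by move=> x; apply/latticeOfP; eexists.
- move=> _ [z _ <-].
  have lt_mod i : (`|((z i 0)%R %% (b 0 i)%R)%Z|%N < `|(b 0 i)%R|)%N.
    have [_ b0 _] := ab i.
    by rewrite -ltz_nat !abszE ger0_norm ?modz_ge0// ltz_mod.
  exists [ffun i => Ordinal (lt_mod i)]; apply/subP => i.
  have [_ b0 _] := ab i.
  rewrite mxE ffunE /= abszE ger0_norm ?modz_ge0//.
  by rewrite -eqz_mod_dvd modz_mod.
- move=> x y /subP bxy; apply/ffunP => i; apply: dvdz_sub_ord.
  by have := bxy i; rewrite !mxE dvdzE.
Qed.

Lemma card_dffun_ord {n} (m : 'I_n -> nat) :
  #|{dffun forall i : 'I_n, 'I_(m i)}| = (\prod_i m i)%N.
Proof.
rewrite card_dep_ffun foldrE big_map big_enum.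
by apply: eq_bigr => i _; rewrite card_ord.
Qed.

Lemma isSubgroup_aligned {n} (a b : 'rV[int]_n) A B : aligned a b A B ->
  isSubgroup A /\ isSubgroup B.
Proof. by move=> [_ [C _ [-> ->]]]; split; exact: isSubgroup_latticeOf. Qed.

Lemma index_sumSet_aligned {n} (a b : 'rV[int]_n) A B : aligned a b A B ->
  finiteIndex (sumSet A B) B /\ grpIndex (sumSet A B) B = (\prod_i `|(b 0 i)%R|)%N.
Proof.
move=> al; have [hA hB] := isSubgroup_aligned al.
have [f fAB] := cosetReps_aligned al.
by rewrite -card_dffun_ord; exact: index_cosetReps (cosetReps_sumSet hB fAB).
Qed.

(** By [adj], the integral part is [(A cap B) x (A' cap B')]. Each factor contributes the index
    [prod |b_i|], and the square root in [nu] undoes the squaring. The four sets are kept general so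
    that both a product lattice and its adjoint are covered. *)
Lemma nu_aligned {d} (a b : 'rV[int]_d) (A B A' B' : set 'cV[R]_d) :
  aligned a b A B -> aligned a b A' B' ->
  adjointLattice (prodSet A A') = prodSet B B' ->
  symplRational (prodSet A A') /\ nu (prodSet A A') = (\prod_i `|(b 0 i)%R|)%N%:R.
Proof.
move=> al al' adj.
have [hA hB] := isSubgroup_aligned al; have [hA' hB'] := isSubgroup_aligned al'.
have [f fAB] := cosetReps_aligned al; have [g gAB] := cosetReps_aligned al'.
have hI : isSubgroup (prodSet A A' `&` prodSet B B').
  have [p0 pB] := isSubgroup_prodSet hA hA'; have [q0 qB] := isSubgroup_prodSet hB hB'.
  by split=> // x y [? ?] [? ?]; split; [exact: pB|exact: qB].
have [fin idx] := index_cosetReps hI (cosetReps_prodSet hA hA' fAB gAB).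
rewrite /symplRational /nu /integralPart adj; split=> //.
by rewrite idx card_prod card_dffun_ord natrM -expr2 sqrtr_sqr ger0_norm.
Qed.

(** Both sides equal [|det C|] times the product of all [|a_i b_i|]. *)
Lemma covol_aligned {n} (a b : 'rV[int]_n) A B : aligned a b A B ->
  covol A * (\prod_i `|(b 0 i)%R|)%N%:R = covol B * (\prod_i `|(a 0 i)%R|)%N%:R.
Proof.
move=> [ab [C uC [-> ->]]].
have ua : ((diag_mx a)^R : 'M[R]_n) \in unitmx.
  by apply: unitmx_diagR => i; case: (ab i).
have ub : ((diag_mx b)^R : 'M[R]_n) \in unitmx.
  by apply: unitmx_diagR => i; case: (ab i).
have detE (c : 'rV[int]_n) : `|\det ((diag_mx c)^R : 'M[R]_n)| = (\prod_i `|(c 0 i)%R|)%N%:R.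
  rewrite det_map_mx det_diag rmorph_prod normr_prod natr_prod.
  by apply: eq_bigr => i _; rewrite natr_absz intr_norm.
by rewrite !covolE ?unitmx_mul ?uC// !det_mulmx !normrM !detE mulrAC.
Qed.

End AlignedLattices.

(** * Criteria for alignment: torsion, discreteness, pigeonhole *)

Section Commensurability.
Context {R : realType}.
Local Notation "A ^R" := (map_mx intr A) (at level 8, format "A ^R").

(** Torsion of the columns of [M] makes [invmx Q *m M] a rational matrix. After clearing
    denominators, its Smith normal form provides bases of the two lattices that differ by a rational
    diagonal matrix, whose entries in lowest terms are [a_i / b_i]. *)
Lemma aligned_of_torsion n (M Q : 'M[R]_n) : M \in unitmx -> Q \in unitmx ->
  (forall v, latticeOf M v -> exists2 N : nat, (0 < N)%N & latticeOf Q (v *+ N)) ->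
  exists a b, aligned a b (latticeOf M) (latticeOf Q).
Proof.
move=> uM uQ tor.
have /choice[F FP] (j : 'I_n) : exists p : nat * 'cV[int]_n,
    (0 < p.1)%N /\ col j M *+ p.1 = Q *m p.2^R.
  have [|N N0 /latticeOfP[z zE]] := tor (col j M); last by exists (N, z).
  by apply/latticeOfP; exists (delta_mx j 0); rewrite map_delta_mx colE.
pose N := (\prod_j (F j).1)%N.
have N0 : (0 < N)%N by apply: prodn_gt0 => j; case: (FP j).
have NR0 : N%:R != 0 :> R by rewrite pnatr_eq0 -lt0n.
have [A NM] : exists A : 'M[int]_n, N%:R *: M = Q *m A^R.
  (* Column [j] needs only its own denominator [(F j).1]; the other factors of [N] multiply its
     integer coordinates. *)
  exists (\matrix_(i, j) ((F j).2 i 0 *+ (\prod_(k | k != j) (F k).1)%N)).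
  apply/matrixP => i j.
  have colE : (F j).1%:R * M i j = (Q *m (F j).2^R) i 0.
    by rewrite -(FP j).2 -[in RHS]scaler_nat !mxE.
  rewrite [LHS]mxE /N (bigD1 j)//= natrM mulrAC colE !mxE mulr_suml.
  by apply: eq_bigr => k _; rewrite !mxE rmorphMn/= -[in RHS]mulr_natr mulrA.
have [U uU [V uV [ds _ AE]]] := int_Smith_normal_form A.
pose s : 'rV[int]_n := \row_j ds`_j.
have {}AE : A = U *m diag_mx s *m V.
  rewrite AE; congr (_ *m _ *m _); apply/matrixP => i j; rewrite !mxE.
  by rewrite (inj_eq val_inj); case: eqP => // ->.
(* A zero invariant factor would make [det A], and hence [N^n det M], vanish. *)
have s0 j : s 0 j != 0.
  have : \det A != 0.
    rewrite -(intr_eq0 R) -det_map_mx; apply/eqP => dA.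
    have := congr1 determinant NM; rewrite det_mulmx dA mulr0 detZ => /eqP.
    by rewrite mulf_eq0 expf_eq0 (negPf NR0) andbF/= -[_ == _]negbK -unitfE -unitmxE uM.
  rewrite AE !det_mulmx !mulf_eq0 !negb_or det_diag => /andP[/andP[_ +] _].
  by move=> /prodf_neq0; apply.
pose q j : rat := (s 0 j)%:~R / N%:R.
pose a : 'rV[int]_n := \row_j numq (q j).
pose b : 'rV[int]_n := \row_j denq (q j).
have ab : coprimePair a b.
  move=> i; rewrite !mxE denq_neq0 numq_eq0; split=> //; last first.
    by rewrite coprimezE coprime_num_den.
  by rewrite mulf_neq0 ?invr_eq0 ?intr_eq0 ?s0// pnatr_eq0 -lt0n.
have ub : ((diag_mx b)^R : 'M[R]_n) \in unitmx.
  by apply: unitmx_diagR => k; have [] := ab k.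
have qE j : N%:Z * numq (q j) = denq (q j) * s 0 j.
  apply: (@intr_inj rat); rewrite !rmorphM/= numqE mulrA [RHS]mulrC.
  by congr (_ * _); rewrite /q mulrC divfK// pnatr_eq0 -lt0n.
have abE : N%:Z *: diag_mx a = diag_mx b *m diag_mx s.
  by rewrite mulmx_diag -linearZ/=; congr diag_mx; apply/rowP => j; rewrite !mxE qE mxE.
exists a, b; split=> //.
(* With this [C], [C diag(b) = Q U], and [N diag(a) = diag(b) diag(s)] yields [C diag(a) V = M]. The
   unimodular [U] and [V] do not change the lattices. *)
exists (Q *m U^R *m invmx (diag_mx b)^R).
  rewrite !unitmx_mul uQ unitmx_inv ub andbT/= unitmxE det_map_mx.
  by move: uU; rewrite unitmxE; exact: rmorph_unit.
split; last by rewrite mulmxKV// latticeOf_mul_unit.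
rewrite -[RHS](latticeOf_mul_unit _ uV); congr latticeOf.
apply: (scalerI NR0); rewrite NM AE !map_mxM -!mulmxA !scalemxAr.
congr (_ *m (_ *m _)); rewrite mulmxA -scalemxAr scalemxAl; congr (_ *m _).
rewrite scalemxAr.
have := congr1 (fun X : 'M[int]_n => X^R : 'M[R]_n) abE.
by rewrite map_mxZ map_mxM/= => ->; rewrite mulKmx.
Qed.

(** By translation, a subgroup is discrete as soon as 0 is isolated in it; balls are those of the
    maximum norm. *)
Lemma discreteSubsetP n (A : set 'cV[R]_n) : isSubgroup A ->
  discreteSubset A <->
  exists2 e : R, 0 < e & forall y, A y -> (forall i, `|y i 0| < e) -> y = 0.
Proof.
move=> hA; split=> [dA|[e e0 he]].
  have := hA.1; rewrite -{1}dA => -[_ [V /nbhs_ballP[e/= e0 eV] VA]].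
  exists e => // y Ay ye; have : (V `&` A) y; last by rewrite VA.
  split=> //; apply: eV; split=> // i j.
  by rewrite /ball/= ord1 mxE sub0r normrN.
apply/seteqP; split=> [|x Ax]; first exact: isolatedS.
split; first exact: mem_set.
exists (ball x e); first exact: nbhsx_ballx.
apply/seteqP; split=> [y [[_ xy] Ay]|_ ->]; last by split=> //; exact: ballxx.
apply/eqP; rewrite eq_sym -subr_eq0; apply/eqP/he; first exact: hA.2.
by move=> i; have := xy i 0; rewrite /ball/= !mxE.
Qed.

(** A crude operator bound for the maximum norm: the sum of all [|Q k j|] dominates every row sum,
    so one constant serves for all [i]. *)
Lemma norm_mulmx_col n (Q : 'M[R]_n) (w : 'cV[R]_n) (e : R) (i : 'I_n) :
  (forall j, `|w j 0| <= e) -> `|(Q *m w) i 0| <= (\sum_k \sum_j `|Q k j|) * e.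
Proof.
move=> we; rewrite mxE; apply: le_trans (ler_norm_sum _ _ _) _.
rewrite [X in X * e](bigD1 i)//= mulrDl mulr_suml.
rewrite ler_wpDr//.
  apply: mulr_ge0; first by apply: sumr_ge0 => k _; apply: sumr_ge0.
  exact: le_trans (we i).
by apply: ler_sum => j _; rewrite normrM ler_wpM2l.
Qed.

(** If [C z] has all coordinates below [1 / (c + 1)], then [|z_i| <= c / (c + 1) < 1], and the
    integers [z_i] vanish. *)
Lemma discrete_sub_lattice n (C : 'M[R]_n) A : C \in unitmx ->
  isSubgroup A -> A `<=` latticeOf C -> discreteSubset A.
Proof.
move=> uC hA AC; apply/discreteSubsetP => //.
pose c := \sum_k \sum_j `|(invmx C) k j|.
have c0 : 0 <= c by apply: sumr_ge0 => k _; apply: sumr_ge0.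
have c1 : 0 < c + 1 by rewrite ltr_wpDl.
exists (c + 1)^-1; first by rewrite invr_gt0.
move=> _ /AC[z _ <-] small; rewrite (_ : z = 0) ?map_mx0 ?mulmx0//.
apply/colP => i; rewrite [RHS]mxE; apply/eqP.
have : `|(invmx C *m (C *m z^R)) i 0| <= c * (c + 1)^-1.
  by apply: norm_mulmx_col => j; exact: ltW.
rewrite mulKmx// mxE -intr_norm => /le_lt_trans-/(_ 1).
rewrite ltr_pdivrMr// mul1r ltrDl ltr01 => /(_ isT).
by rewrite ltrz1 -[_ < 1]/(_ < 0 + 1) ltzD1 normr_le0.
Qed.

(* Pigeonhole on the fractional parts of the coordinates of [v *+ k] in the basis
   [Q], cut into boxes of side [1 / m.+1]. *)
Lemma discrete_torsion n (Q : 'M[R]_n) A v : Q \in unitmx -> isSubgroup A ->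
  latticeOf Q `<=` A -> discreteSubset A -> A v ->
  exists2 N : nat, (0 < N)%N & latticeOf Q (v *+ N).
Proof.
move=> uQ hA QA /(discreteSubsetP hA)[e e0 he] Av.
pose c := \sum_k \sum_j `|Q k j|.
have c0 : 0 <= c by apply: sumr_ge0 => k _; apply: sumr_ge0.
(* Fine enough that [Q] maps vectors with coordinates at most [1 / m.+1] to vectors with coordinates
   below [e]. *)
pose m := Num.bound (c / e).
have ce : c / m.+1%:R < e.
  rewrite ltr_pdivrMr ?ltr0n// mulrC -ltr_pdivrMr//.
  apply: lt_le_trans (archi_boundP _) _; first by rewrite divr_ge0// ltW.
  by rewrite ler_nat.
pose x := invmx Q *m v.
pose z k : 'cV[int]_n := \col_i Num.floor ((x *+ k) i 0).
pose r k := x *+ k - (z k)^R.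
have r01 k i : 0 <= r k i 0 < 1.
  rewrite !mxE subr_ge0 ltrBlDl; have /andP[-> /=] := floor_itv ((x *+ k) i 0).
  by rewrite intrD.
pose t k i := Num.truncn (r k i 0 * m.+1%:R).
have tm k i : (t k i < m.+1)%N.
  have /andP[r0 r1] := r01 k i.
  rewrite -(ltr_nat R); apply: le_lt_trans (_ : _ <= r k i 0 * m.+1%:R) _.
    by have /andP[] := truncn_itv (mulr_ge0 r0 (ler0n R m.+1)).
  by rewrite gtr_pMl// ltr0n.
have [|k [l [kl tkl]]] := @finite_range_collision _
    (fun k => [ffun i => Ordinal (tm k i)] : {ffun 'I_n -> 'I_m.+1}).
  exact: finite_finset.
exists (l - k)%N; first by rewrite subn_gt0.
have close i : `|(r l - r k) i 0| <= m.+1%:R^-1.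
  have te : t l i = t k i.
    by have /ffunP/(_ i) := tkl; rewrite !ffunE => -[].
  have m0 : 0 < m.+1%:R :> R by rewrite ltr0n.
  have /andP[rl0 _] := r01 l i; have /andP[rk0 _] := r01 k i.
  have := truncn_itv (mulr_ge0 rl0 (ltW m0)).
  have := truncn_itv (mulr_ge0 rk0 (ltW m0)).
  rewrite -/(t l i) -/(t k i) te -natr1 => /andP[k1 k2] /andP[l1 l2].
  rewrite mxE [X in _ + X]mxE -[_^-1]mul1r ler_pdivlMr// -[X in _ * X]ger0_norm//.
  rewrite -normrM mulrBl ler_norml; apply/andP; split; lra.
have vE : v *+ (l - k) = Q *m (x *+ (l - k)) by rewrite [RHS]raddfMn/= mulKVmx.
apply/latticeOfP; exists (z l - z k); rewrite vE.
apply/eqP; rewrite -subr_eq0 -mulmxBr; apply/eqP.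
have rE : x *+ (l - k) - (z l - z k)^R = r l - r k.
  by rewrite mulrnBr ?(ltnW kl)// map_mxB /r !opprD !opprK addrACA.
(* The vector [Q *m (r l - r k)] is [v *+ (l - k)] minus an element of [latticeOf Q], so it lies in
   [A]; its coordinates are below [e], so it is 0. *)
rewrite rE; apply: he.
  rewrite -rE mulmxBr -vE; apply: hA.2; first exact: isSubgroupMn.
  by apply: QA; apply/latticeOfP; exists (z l - z k).
by move=> i; apply: le_lt_trans ce; exact: norm_mulmx_col.
Qed.

Lemma discrete_aligned n (a b : 'rV[int]_n) (A B : set 'cV[R]_n) : aligned a b A B ->
  discreteSubset (sumSet A B).
Proof.
move=> al; have [hA hB] := isSubgroup_aligned al.
case: al => _ [C uC [AE BE]].
apply: (discrete_sub_lattice uC); first exact: isSubgroup_sumSet.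
rewrite AE BE => _ [_ [y _ <-] [_ [z _ <-] <-]]; apply/latticeOfP.
exists (diag_mx a *m y + diag_mx b *m z).
by rewrite map_mxD !map_mxM mulmxDr !mulmxA.
Qed.

End Commensurability.

(** * Alignment from rationality or discreteness, and the equivalence of the two conditions *)

(** For [v] in the first factor, some positive multiple of [(v, 0)] lies in the integral part, whose
    first components belong to [latticeOf Q]. So [v] is torsion modulo [latticeOf Q]. *)
Lemma symplRational_aligned (R : realType) d (M Q : 'M[R]_d) A :
  M \in unitmx -> Q \in unitmx -> isSubgroup A ->
  dualLattice A = latticeOf Q -> symplRational (prodSet (latticeOf M) A) ->
  exists a b, aligned a b (latticeOf M) (latticeOf Q).
Proof.
move=> uM uQ hA AQ sr; have hM := isSubgroup_latticeOf M.
have adj : adjointLattice (prodSet (latticeOf M) A) =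
    prodSet (latticeOf Q) (dualLattice (latticeOf M)).
  by rewrite adjointLattice_prodSet ?AQ//; [exact: hM.1|exact: hA.1].
have hL := isSubgroup_prodSet hM hA.
have hI : isSubgroup (integralPart (prodSet (latticeOf M) A)).
  rewrite /integralPart adj dualLattice_latticeOf//.
  have [p0 pB] := isSubgroup_prodSet (isSubgroup_latticeOf Q)
    (isSubgroup_latticeOf (invmx M^T)).
  by split; [split=> //; exact: hL.1|move=> x y [? ?] [? ?]; split; [exact: hL.2|exact: pB]].
apply: aligned_of_torsion => // v Mv.
have Lv : prodSet (latticeOf M) A (col_mx v 0) by apply/prodSetP; split; [|exact: hA.1].
have [N N0 []] := finiteIndex_torsion hL hI sr Lv.
rewrite adj => _ [x Qx [y _ /(congr1 usubmx)]].
by rewrite col_mxKu [RHS]raddfMn/= col_mxKu => xv; exists N; rewrite -?xv.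
Qed.

Lemma discrete_sumSet_aligned (R : realType) n (M Q : 'M[R]_n) :
  M \in unitmx -> Q \in unitmx ->
  discreteSubset (sumSet (latticeOf M) (latticeOf Q)) ->
  exists a b, aligned a b (latticeOf M) (latticeOf Q).
Proof.
move=> uM uQ dG; have hM := isSubgroup_latticeOf M; have hQ := isSubgroup_latticeOf Q.
apply: aligned_of_torsion => // v Mv.
apply: (discrete_torsion uQ (isSubgroup_sumSet hM hQ) _ dG).
  by move=> w Qw; exists 0; [exact: hM.1|exists w; rewrite ?add0r].
by exists v => //; exists 0; [exact: hQ.1|rewrite addr0].
Qed.

Lemma dualLatticeK (R : realType) n (M : 'M[R]_n) : M \in unitmx ->
  dualLattice (dualLattice (latticeOf M)) = latticeOf M.
Proof.
move=> uM; rewrite !dualLattice_latticeOf ?unitmx_inv ?unitmx_tr//.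
by rewrite trmx_inv trmxK invmxK.
Qed.

Lemma discrete_fullRankLattice (R : realType) n (A : set 'cV[R]_n) :
  fullRankLattice A -> discreteSubset A.
Proof.
by move=> [C uC ->]; apply: (discrete_sub_lattice uC) => //; exact: isSubgroup_latticeOf.
Qed.

Theorem proposition1p17 (R : realType) (d : nat) (d_gt0 : (0 < d)%N)
    (Gamma Phi : set 'cV[R]_d)
    (hGamma : fullRankLattice Gamma) (hPhi : fullRankLattice Phi) :
  let Lambda := prodSet Gamma Phi in
  let P := dualLattice Phi in
  let GP := sumSet Gamma P in
  [/\ condSG Lambda <-> condTeP Gamma P,
      ~ discreteSubset GP ->
        [/\ condSG Lambda <-> covol Gamma < covol P,
            condTeP Gamma P <-> covol Gamma < covol P
          & covol Gamma < covol P <-> covol Lambda < 1]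
    & fullRankLattice GP ->
        [/\ (symplRational Lambda /\ symplRational (adjointLattice Lambda)),
            (finiteIndex GP P /\ finiteIndex GP Gamma),
            (nu Lambda = (grpIndex GP P)%:R /\
             nu (adjointLattice Lambda) = (grpIndex GP Gamma)%:R),
            condSG Lambda <-> (grpIndex GP Gamma + d <= grpIndex GP P)%N
          & condTeP Gamma P <-> (grpIndex GP Gamma + d <= grpIndex GP P)%N]].
Proof.
move=> Lambda P GP.
case: hGamma hPhi => M uM GammaE [W uW PhiE].
have hG : isSubgroup Gamma by rewrite GammaE; exact: isSubgroup_latticeOf.
have hF : isSubgroup Phi by rewrite PhiE; exact: isSubgroup_latticeOf.
pose Q := invmx W^T; have uQ : Q \in unitmx by rewrite unitmx_inv unitmx_tr.
have PE : P = latticeOf Q by rewrite /P PhiE dualLattice_latticeOf.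
have PK : dualLattice P = Phi by rewrite /P PhiE dualLatticeK.
have adj : adjointLattice Lambda = prodSet P (dualLattice Gamma).
  by rewrite adjointLattice_prodSet//; [exact: hG.1|exact: hF.1].
(* Since [covol P] is the inverse of [covol Phi], the covolume of [Lambda] is
   [covol Gamma / covol P]. *)
have covolE : covol Gamma < covol P <-> covol Lambda < 1.
  rewrite /Lambda /P GammaE PhiE covol_prodSet// covol_dualLattice//.
  by rewrite -[_ < 1]ltr_pdivlMr ?covol_latticeOf_gt0// div1r.
have [[a [b al]]|nal] := pselect (exists a b, aligned a b Gamma P).
  have dis : discreteSubset GP := discrete_aligned al.
  have ald := aligned_dual al; rewrite PK in ald.
  (* Biduality: this is the adjoint hypothesis of [nu_aligned] when it is applied to the adjoint
     lattice with [a] and [b] exchanged. *)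
  have adj' : adjointLattice (adjointLattice Lambda) = Lambda.
    have P0 : P 0 by rewrite PE; exact: (isSubgroup_latticeOf _).1.
    have G0 : dualLattice Gamma 0.
      by rewrite GammaE dualLattice_latticeOf//; exact: (isSubgroup_latticeOf _).1.
    have GK : dualLattice (dualLattice Gamma) = Gamma by rewrite GammaE dualLatticeK.
    by rewrite adj adjointLattice_prodSet// GK PK.
  have [sr nuL] := nu_aligned al ald adj.
  have [sr' nuL'] : symplRational (adjointLattice Lambda) /\
      nu (adjointLattice Lambda) = (\prod_i `|(a 0 i)%R|)%N%:R.
    move: adj'; rewrite adj => adj'.
    exact: nu_aligned (aligned_sym al) (aligned_sym ald) adj'.
  have [finP idxP] := index_sumSet_aligned al.
  have [finG idxG] := index_sumSet_aligned (aligned_sym al).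
  rewrite sumSetC in finG idxG.
  (* As [d] is positive, the index inequality gives [prod |a_i| < prod |b_i|], which [covol_aligned]
     converts into the covolume inequality. *)
  have cov : (grpIndex GP Gamma + d <= grpIndex GP P)%N -> covol Gamma < covol P.
    have := covol_aligned al; rewrite -/P -/GP idxP idxG => cE le.
    have cP : 0 < covol P by rewrite PE covol_latticeOf_gt0.
    have lt : (\prod_i `|(a 0 i)%R| < \prod_i `|(b 0 i)%R|)%N.
      by apply: leq_trans le; rewrite -addn1 leq_add2l.
    rewrite -(ltr_pM2r (x := (\prod_i `|(b 0 i)%R|)%N%:R)) ?ltr0n ?(leq_ltn_trans _ lt)//.
    by rewrite cE ltr_pM2l// ltr_nat.
  have SG : condSG Lambda <-> (grpIndex GP Gamma + d <= grpIndex GP P)%N.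
    rewrite /condSG /Delta -covolE nuL nuL' lerBrDl -natrD ler_nat -idxP -idxG.
    by split=> [[_]|le]; [exact|split=> //; exact: cov].
  have TP : condTeP Gamma P <-> (grpIndex GP Gamma + d <= grpIndex GP P)%N.
    by split=> [[_]|le]; [exact|split=> //; exact: cov].
  split=> // [|_]; first by rewrite SG TP.
  by split=> //; rewrite nuL nuL' idxP idxG.
(* Without alignment, neither discreteness nor rationality can hold, so the index clauses of both
   conditions are vacuous. *)
have ndis : ~ discreteSubset GP.
  by move=> dis; apply: nal; rewrite GammaE PE; apply: discrete_sumSet_aligned;
    rewrite -?GammaE -?PE.
have nsr : ~ symplRational Lambda.
  move=> sr; apply: nal; rewrite GammaE PE.
  by apply: symplRational_aligned hF _ _; rewrite -?GammaE -?PE.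
have SG : condSG Lambda <-> covol Gamma < covol P.
  by rewrite /condSG -covolE; split=> [[]//|cv]; split=> // /nsr.
have TP : condTeP Gamma P <-> covol Gamma < covol P.
  by split=> [[]//|cv]; split=> // /ndis.
split=> // [|/discrete_fullRankLattice/ndis//].
by rewrite SG TP.
Qed.
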